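(* Let $n\ge2$ and $1\le k\le n-1$ be integers, and let $d$ be a positive integer with $d\mid n$ and $d\mid k$. If $x=(x_1,\dots,x_n)$ is a vector of positive reals, with indices modulo $n$, such that $x_{i+d}=x_i$ for $i=1,\dots,n$, then \[ S_{n,k}(x)=\frac nk . \] In particular, if $1<d<n$, this gives a nonconstant family of points $x$ with $S_{n,k}(x)=n/k$.
   Context: Indices are modulo $n$. For $x_i>0$, $S_{n,k}(x)=\sum_{i=1}^n\frac{x_i}{x_{i+1}+\cdots+x_{i+k}}$. *)

(* Defs.v *)
From HB Require Import structures.
From mathcomp Require Import all_boot all_order all_algebra.

Set Implicit Arguments.
Unset Strict Implicit.
Unset Printing Implicit Defensive.

Import Order.TTheory GRing.Theory Num.Theory.
Local Open Scope ring_scope.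

Lemma cyc_add_subproof (n : nat) (i : 'I_n) (m : nat) : ((i + m) %% n < n)%N.
Proof. by rewrite ltn_pmod // (leq_ltn_trans (leq0n i)). Qed.

(* The index i + m, read modulo n. *)
Definition cyc_add (n : nat) (i : 'I_n) (m : nat) : 'I_n :=
  Ordinal (cyc_add_subproof i m).

(* Indices run over 0, ..., n-1 instead of 1, ..., n; since they are cyclic
   this only renames the coordinate n as 0. *)
Definition cyc_sum (R : realFieldType) (n k : nat) (x : 'rV[R]_n) : R :=
  \sum_(i < n) x 0 i / \sum_(1 <= j < k.+1) x 0 (cyc_add i j).

Definition positive_vec (R : realFieldType) (n : nat) (x : 'rV[R]_n) : Prop :=
  forall i : 'I_n, 0 < x 0 i.

Definition cyc_periodic (R : realFieldType) (n d : nat) (x : 'rV[R]_n) : Prop :=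
  forall i : 'I_n, x 0 (cyc_add i d) = x 0 i.

Definition nonconstant_vec (R : realFieldType) (n : nat) (x : 'rV[R]_n) : Prop :=
  exists i j : 'I_n, x 0 i != x 0 j.

(* Main.v *)
(* Both the k consecutive terms in each denominator and the n numerators
   consist of full periods, k / d and n / d of them; writing P for the sum over
   one period, the cyclic sum is (n / d) P / ((k / d) P). *)
Require Import Defs.
From HB Require Import structures.
From mathcomp Require Import all_boot all_order all_algebra.

Set Implicit Arguments.
Unset Strict Implicit.
Unset Printing Implicit Defensive.

Import Order.TTheory GRing.Theory Num.Theory.
Local Open Scope ring_scope.

(** Moving the window one step right drops [f a] and gains [f (a + d)], which are equal. *)
Lemma sum_period_shift (V : nmodType) (d : nat) (f : nat -> V) (a : nat) :
  (forall m, f (m + d)%N = f m) ->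
  \sum_(a <= j < a + d) f j = \sum_(0 <= j < d) f j.
Proof.
move=> fd; elim: a => [|a IHa]; first by rewrite add0n.
(* A first and a last term can be split off only when [d] is positive; for [d = 0] both sums are
   empty. *)
rewrite -IHa; case: d fd {IHa} => [|d] fd; first by rewrite !addn0 !big_geq.
rewrite addSn big_nat_recr ?addnS ?ltnS ?leq_addr //=.
rewrite [RHS]big_ltn ?ltnS ?leq_addr // addrC.
by congr (_ + _); rewrite -addnS fd.
Qed.

Lemma sum_periods (V : nmodType) (d q : nat) (f : nat -> V) (a : nat) :
  (forall m, f (m + d)%N = f m) ->
  \sum_(a <= j < a + q * d) f j = (\sum_(0 <= j < d) f j) *+ q.
Proof.
move=> fd; elim: q => [|q IHq]; first by rewrite mul0n addn0 big_geq.
rewrite mulSnr addnA (big_cat_nat (n := a + q * d)) ?leq_addr //=.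
by rewrite IHq sum_period_shift // mulrSr.
Qed.

Lemma cyc_addD (n : nat) (i : 'I_n) (a b : nat) :
  cyc_add (cyc_add i a) b = cyc_add i (a + b).
Proof. by apply: val_inj; rewrite /= modnDml addnA. Qed.

Lemma cyc_add_ord0 (n : nat) (i : 'I_n.+1) : cyc_add ord0 i = i.
Proof. by apply: val_inj; rewrite /= add0n modn_small. Qed.

Lemma cyc_sum_periodic (R : realFieldType) (n k d : nat) (x : 'rV[R]_n) :
  (0 < k)%N -> (0 < d)%N -> (d %| n)%N -> (d %| k)%N ->
  positive_vec x -> cyc_periodic d x -> cyc_sum k x = n%:R / k%:R.
Proof.
move=> k0 d0 dn dk; case: n dn x => [|n] dn x xpos xper.
  by rewrite /cyc_sum big_ord0 mul0r.
(* Unrolling [x] into a [d]-periodic sequence on all naturals turns cyclic windows into plain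
   intervals. *)
pose f m := x 0 (cyc_add ord0 m).
have fd m : f (m + d)%N = f m by rewrite /f -cyc_addD xper.
pose P := \sum_(0 <= j < d) f j.
have P0 : P != 0.
  rewrite /P big_ltn // gt_eqF // ltr_wpDr ?xpos //.
  by apply: sumr_ge0 => j _; apply: ltW; exact: xpos.
have denE (i : 'I_n.+1) :
    \sum_(1 <= j < k.+1) x 0 (cyc_add i j) = P *+ (k %/ d).
  (* The denominator at [i] is the sum of [f] over the [k] indices from [i + 1] to [i + k]. *)
  rewrite -(sum_periods _ i.+1 fd) divnK //.
  have -> : (i.+1 + k = k.+1 + i)%N by rewrite addSn addnC addSn.
  rewrite -[i.+1]add1n big_addn addnK.
  by apply: eq_bigr => j _; rewrite /f addnC -cyc_addD cyc_add_ord0.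
have numE : \sum_(i < n.+1) x 0 i = P *+ (n.+1 %/ d).
  rewrite -(sum_periods _ 0 fd) divnK // add0n big_mkord.
  by apply: eq_bigr => i _; rewrite /f cyc_add_ord0.
rewrite /cyc_sum; under eq_bigr do rewrite denE.
(* On the right, [n.+1] and [k] become multiples of [d]; both sides are then the same ratio of
   quotients, times [P / P] on the left and [d / d] on the right. *)
rewrite -mulr_suml numE -{2}(divnK dn) -{2}(divnK dk) !natrM.
rewrite -!(mulr_natr P) !(mulrC P) -!mulf_div.
by rewrite !divff ?pnatr_eq0 -?lt0n.
Qed.

Theorem theorem5p1 (R : realFieldType) (n k d : nat)
    (hn : (2 <= n)%N) (hk : (1 <= k <= n - 1)%N)
    (hd : (0 < d)%N) (hdn : (d %| n)%N) (hdk : (d %| k)%N) :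
  (forall x : 'rV[R]_n, positive_vec x -> cyc_periodic d x ->
     cyc_sum k x = n%:R / k%:R) /\
  ((1 < d < n)%N ->
   exists F : 'rV[R]_d -> 'rV[R]_n,
     [/\ forall c : 'rV[R]_d, positive_vec c ->
           [/\ positive_vec (F c), cyc_periodic d (F c)
             & cyc_sum k (F c) = n%:R / k%:R],
         forall (c : 'rV[R]_d) (j : 'I_d) (i : 'I_n),
           i = j :> nat -> F c 0 i = c 0 j,
         forall c : 'rV[R]_d, nonconstant_vec c -> nonconstant_vec (F c)
       & exists c : 'rV[R]_d, positive_vec c /\ nonconstant_vec c]).
Proof.
have k0 : (0 < k)%N by case/andP: hk.
have main (x : 'rV[R]_n) : positive_vec x -> cyc_periodic d x ->
    cyc_sum k x = n%:R / k%:R by exact: cyc_sum_periodic.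
split=> // /andP[d1 dltn].
(* The block [c] is repeated [n / d] times, so its [d] entries are the free parameters of the
   family. *)
pose F (c : 'rV[R]_d) : 'rV[R]_n :=
  \row_i c 0 (Ordinal (ltn_pmod i hd)).
have FE (c : 'rV[R]_d) (j : 'I_d) (i : 'I_n) :
    i = j :> nat -> F c 0 i = c 0 j.
  move=> ij; rewrite mxE; congr (c 0 _).
  by apply: val_inj; rewrite /= ij modn_small.
exists F; split=> //.
- move=> c cpos.
  have Fpos : positive_vec (F c) by move=> i; rewrite mxE; exact: cpos.
  have Fper : cyc_periodic d (F c).
    move=> i; rewrite !mxE; congr (c 0 _).
    (* Since [d] divides [n], wrapping around modulo [n] does not change the residue modulo [d]. *)
    by apply: val_inj; rewrite /= modn_dvdm // modnDr.
  by split=> //; exact: main.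
- move=> c [i [j cij]].
  (* The first [d] coordinates of [F c] are [c] itself, so two differing entries survive. *)
  exists (widen_ord (ltnW dltn) i), (widen_ord (ltnW dltn) j).
  by rewrite (FE c i) // (FE c j).
(* The block 1, 2, ..., d has distinct first two entries, and [1 < d] makes the second one exist. *)
- exists (\row_j j.+1%:R); split; first by move=> i; rewrite mxE ltr0Sn.
  by exists (Ordinal hd), (Ordinal d1); rewrite !mxE eqr_nat.
Qed.
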